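(* Let $m\ge1$. For any pair of $m$-Dyck paths $P\in\mathrm{Dy}_{n_1}^m$ and $Q\in\mathrm{Dy}_{n_2}^m$ ($n_1,n_2\ge1$) and any integer $0\le i\le m$, the product $*_i$ is given in terms of the $m$-Tamari order on $\mathrm{Dy}_{n_1+n_2}^m$ by $$P*_iQ=\sum_{P/_iQ\,\le\, Z\,\le\, P\backslash_iQ}Z .$$
   Context: $\mathbb K$ is a field. Fix $m\ge1$. An $m$-Dyck path of size $n$ is a path in $\mathbb R^2$ from $(0,0)$ to $(2nm,0)$ made of up steps $(m,m)$ and down steps $(1,-1)$, never going below the $x$-axis (so it has $n$ up steps). $\mathrm{Dy}_n^m$ is the set of those of size $n$, and $\mathbb K[\mathrm{Dy}^m]$ is the vector space with basis $\bigcup_{n\ge1}\mathrm{Dy}_n^m$. A down step has level $k$ if the last up step before it is the $k$-th up step from the left; $L_k(P)$ is the number of down steps of level $k$, and $L(P):=L_n(P)$ for $P$ of size $n$. A path is determined by, and written as, $((L_1(P),\dots,L_{n-1}(P),L(P)))$. Concatenations: for $P$ of size $n$, $Q$ of size $r$, $0\le i\le L(P)$, $P\times_iQ:=((L_1(P),\dots,L_{n-1}(P),L(P)-i,L_1(Q),\dots,L_{r-1}(Q),L(Q)+i))$. A path is prime if it is not of the form $Q\times_0R$ with $Q,R$ of size $\ge1$. Every path of size $\ge 1$ is uniquely $Q_1\times_0\dots\times_0Q_r$ with all $Q_j$ prime of size $\geq 1$. Standard coloring $\alpha_P$ from the down steps of $P$ to $\{1,\dots,n\}$: write uniquely $P=u\,P_0\,d\,P_1\,d\cdots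 d\,P_m$, where $u$ is the first up step, the $m$ displayed $d$ are down steps, and $P_j$ is a (possibly empty, translated) $m$-Dyck path of size $n_j$; then $\alpha_P=1$ on the displayed down steps and $\alpha_P(d)=\alpha_{P_j}(d)+n_0+\dots+n_{j-1}+1$ for $d$ in $P_j$. For $P$ of size $n$, $\omega_n^P$ is the word of colors of the down steps of level $n$, read left to right (length $L(P)$). Let $\Lambda_r(P)$ be the set of $\lambda=(\lambda_0,\dots,\lambda_r)$ of non-negative integers with sum $L(P)$, and $\Lambda_r^i(P)$ ($0\le i\le m$) the subset of those $\lambda$ such that in the word formed by the last $\lambda_r$ letters of $\omega_n^P$ every color appears at most $i$ times and some integer of $\{1,\dots,n\}$ appears exactly $i$ times (so $\lambda\in\Lambda_r^0(P)$ iff $\lambda_r=0$). For $Q=Q_1\times_0\dots\times_0Q_r$ with $Q_j$ prime and $\lambda\in\Lambda_r(P)$, $$P*_\lambda Q:=(\cdots((P\times_{\lambda_1+\dots+\lambda_r}Q_1)\times_{\lambda_2+\dots+\lambda_r}Q_2)\cdots)\times_{\lambda_r}Q_r .$$ Finally $P*_jQ:=\sum_{\lambda\in\Lambda_r^j(P)}P*_\lambda Q$ for $0\le j\le m$. Bounds: $c_i(P)$ (resp. $C_i(P)$) is the minimal (resp. maximal) integer $c$ such that, in the word formed by the last $c$ letters of $\omega_n^P$, some integer in $\{1,\dots,n\}$ appears exactly $i$ times and no integer appears more than $i$ times. With $Q=Q_1\times_0\dots\times_0Q_r$, $Q_j$ prime, put $P/_iQ:=P\times_{c_i(P)}Q$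 and $P\backslash_iQ:=(P\times_{L(P)}(Q_1\times_0\dots\times_0Q_{r-1}))\times_{C_i(P)}Q_r$ (for $r=1$ this means $P\times_{C_i(P)}Q_1$). $m$-Tamari order: if a down step $d$ of $P$ is immediately followed by an up step $u$, let $P_u$ (the excursion of $u$) be the shortest subpath of $P$ starting with $u$ that is a translated $m$-Dyck path of size $\geq 1$; $P_{(d)}$ is obtained from $P$ by exchanging $d$ and $P_u$ (so $\dots d\,P_u\dots$ becomes $\dots P_u\,d\dots$). The $m$-Tamari order on $\mathrm{Dy}_n^m$ is the reflexive transitive closure of the covering relations $P\lessdot P_{(d)}$. *)

(* Defs.v *)
From HB Require Import structures.
From mathcomp Require Import all_boot all_order all_algebra.
From mathcomp Require Import zify.
From mathcomp Require Export monalg.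

Set Implicit Arguments.
Unset Strict Implicit.
Unset Printing Implicit Defensive.

Import GRing.Theory.

(* A path is the word of its steps: [up] is the step (m, m), [dn] the step    *)
(* (1, -1).                                                                   *)
Notation up := true (only parsing).
Notation dn := false (only parsing).
Notation path_word := (seq bool).

Definition nup (w : path_word) : nat := count_mem up w.
Definition ndn (w : path_word) : nat := count_mem dn w.

(* After the prefix [take k w] the path is at height m * nup - ndn. The empty *)
(* word is a path of size 0.                                                  *)
Definition is_mdyck (m : nat) (w : path_word) : bool :=
  (ndn w == m * nup w) &&
  all (fun k => ndn (take k w) <= m * nup (take k w)) (iota 0 (size w).+1).

(* The m-Dyck paths of size at least 1; they index the basis of K[Dy^m].      *)
Record mdyck (m : nat) := MDyck {
  mdyck_word :> path_word;
  _ : is_mdyck m mdyck_word && (0 < nup mdyck_word) }.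
HB.instance Definition _ m := [isSub for @mdyck_word m].
HB.instance Definition _ m := [Countable of mdyck m by <:].

Record Dy (m n : nat) := DyckOfSize {
  Dy_path :> mdyck m;
  _ : nup Dy_path == n }.
HB.instance Definition _ m n := [isSub for @Dy_path m n].
HB.instance Definition _ m n := [Countable of Dy m n by <:].

Lemma nup_ndn w : nup w + ndn w = size w.
Proof.
rewrite /nup /ndn -(count_predC (pred1 up)); congr addn.
by apply: eq_count => -[].
Qed.

Lemma size_Dy m n (P : Dy m n) : size (P : path_word) == n * m.+1.
Proof.
case: P => -[w /= /andP[/andP[/eqP e _] _]] /= /eqP <-.
by rewrite -nup_ndn e mulnS mulnC.
Qed.

Definition Dy_tuple m n (P : Dy m n) : (n * m.+1).-tuple bool :=
  Tuple (size_Dy P).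
Definition tuple_Dy m n (t : (n * m.+1).-tuple bool) : option (Dy m n) :=
  obind insub (insub (tval t) : option (mdyck m)).
Lemma Dy_tupleK m n : pcancel (@Dy_tuple m n) (@tuple_Dy m n).
Proof. by move=> P; rewrite /tuple_Dy /= valK /= valK. Qed.
HB.instance Definition _ m n : isFinite (Dy m n) := PCanIsFinite (@Dy_tupleK m n).

Fixpoint levels_from (k : nat) (w : path_word) : seq nat :=
  match w with
  | [::] => [::]
  | up :: w' => levels_from k.+1 w'
  | dn :: w' => k :: levels_from k w'
  end.

(* The levels of the down steps of w, from left to right.                     *)
Definition levels (w : path_word) : seq nat := levels_from 0 w.
Definition L_ (k : nat) (w : path_word) : nat := count_mem k (levels w).
Definition L (w : path_word) : nat := L_ (nup w) w.

(* The path written ((l_1, ..., l_n)).                                        *)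
Definition of_levels (ls : seq nat) : path_word :=
  flatten [seq up :: nseq l dn | l <- ls].

Definition cat_word (P : path_word) (i : nat) (Q : path_word) : path_word :=
  of_levels ([seq L_ k P | k <- iota 1 (nup P).-1] ++ (L P - i)
          :: [seq L_ k Q | k <- iota 1 (nup Q).-1] ++ [:: L Q + i]).

(* P x_i Q, with the junk value P when L P < i.                               *)
Definition cat_at m (P : mdyck m) (i : nat) (Q : mdyck m) : mdyck m :=
  insubd P (cat_word P i Q).

Definition prime_path m (P : mdyck m) : Prop :=
  forall Q R : mdyck m, P <> cat_at Q 0 R.

(* Q_1 x_0 Q_2 x_0 ... x_0 Q_r                                                *)
Definition concat0 m (Q1 : mdyck m) (Qs : seq (mdyck m)) : mdyck m :=
  foldl (fun X Y => cat_at X 0 Y) Q1 Qs.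

(* The shortest prefix of w that is an m-Dyck path of size at least 1.        *)
Definition excursion (m : nat) (w : path_word) : path_word :=
  take (find (fun k => is_mdyck m (take k w)) (iota 1 (size w))).+1 w.

Fixpoint factor_words (m fuel : nat) (w : path_word) : seq path_word :=
  if fuel is f.+1 then
    if w is [::] then [::] else
    excursion m w :: factor_words m f (drop (size (excursion m w)) w)
  else [::].

(* The sequence Q_1, ..., Q_r of prime paths with Q = Q_1 x_0 ... x_0 Q_r;    *)
(* see prime_factorsP below.                                                  *)
Definition prime_factors m (Q : mdyck m) : seq (mdyck m) :=
  pmap insub (factor_words m (size (Q : path_word)) Q).

(* The words P_0, ..., P_j such that w = P_0 d P_1 d ... d P_j: each P_k      *)
(* with k < j is the longest m-Dyck prefix of what remains.                   *)
Fixpoint split_dn (m j : nat) (w : path_word) : seq path_word :=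
  if j is j'.+1 then
    let k := last 0 [seq k <- iota 0 (size w).+1 | is_mdyck m (take k w)] in
    take k w :: split_dn m j' (drop k.+1 w)
  else [:: w].

(* s_0 ++ x :: s_1 ++ ... ++ x :: s_j                                         *)
Definition glue (T : Type) (x : T) (ss : seq (seq T)) : seq T :=
  behead (flatten [seq x :: s | s <- ss]).

(* One step of the recursion: Ps is P_0, ..., P_m and [rec] colors each P_j.  *)
Definition color_node (rec : path_word -> seq nat) (Ps : seq path_word) :=
  glue 1 [seq [seq c + sumn [seq nup P | P <- take j Ps] + 1
                 | c <- rec (nth [::] Ps j)]
            | j <- iota 0 (size Ps)].

Fixpoint coloring_rec (m fuel : nat) (w : path_word) : seq nat :=
  if fuel is f.+1 then
    if w is _ :: w' then color_node (coloring_rec m f) (split_dn m m w')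
    else [::]
  else [::].

(* The standard coloring: the colors of the down steps, from left to right;   *)
(* see coloring_node below.                                                   *)
Definition coloring (m : nat) (w : path_word) : seq nat :=
  coloring_rec m (size w) w.

Definition omega (m : nat) (P : path_word) : seq nat :=
  [seq lc.2 | lc <- zip (levels P) (coloring m P) & lc.1 == nup P].

Definition last_letters (c : nat) (w : seq nat) : seq nat := drop (size w - c) w.

(* In the last c letters of omega, no integer of {1, ..., n} appears more     *)
(* than i times, and some integer of {1, ..., n} appears exactly i times.     *)
Definition exact_max (m i : nat) (P : path_word) (c : nat) : bool :=
  let w := last_letters c (omega m P) in
  all (fun k => count_mem k w <= i) (iota 1 (nup P)) &&
  has (fun k => count_mem k w == i) (iota 1 (nup P)).

(* c_i(P) and C_i(P), as the first and last element of the increasing         *)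
(* sequence of admissible integers; this is nonempty for 0 <= i <= m.         *)
Definition admissible (m i : nat) (P : path_word) : seq nat :=
  [seq c <- iota 0 (L P).+1 | exact_max m i P c].
Definition cmin (m i : nat) (P : path_word) : nat := head 0 (admissible m i P).
Definition cmax (m i : nat) (P : path_word) : nat := last 0 (admissible m i P).

(* The entries of lambda are bounded by L P, being nonnegative of sum L P.    *)
Definition Lambda (r : nat) (P : path_word) : {set {ffun 'I_r.+1 -> 'I_(L P).+1}} :=
  [set la : {ffun 'I_r.+1 -> 'I_(L P).+1} | \sum_(k < r.+1) la k == L P].

Definition LambdaI (m i r : nat) (P : path_word) :
    {set {ffun 'I_r.+1 -> 'I_(L P).+1}} :=
  [set la in Lambda r P | exact_max m i P (fun_of_fin la ord_max)].

(* P *_lambda (Q_1 x_0 ... x_0 Q_r). The index j : 'I_r stands for j + 1, so  *)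
(* that the j-th factor is inserted at lambda_{j+1} + ... + lambda_r.         *)
Definition star_lambda m (P : mdyck m) (Qs : seq (mdyck m))
    (la : {ffun 'I_(size Qs).+1 -> 'I_(L P).+1}) : mdyck m :=
  foldl (fun X (j : 'I_(size Qs)) =>
           cat_at X (\sum_(k < (size Qs).+1 | j < k) la k) (tnth (in_tuple Qs) j))
        P (enum 'I_(size Qs)).

Arguments star_lambda [m] P Qs la.

Definition star (K : fieldType) m (i : nat) (P Q : mdyck m) : {malg K[mdyck m]} :=
  (\sum_(la in LambdaI m i (size (prime_factors Q)) P)
      << star_lambda P (prime_factors Q) la >>)%R.

Definition slash_path m (P : mdyck m) (i : nat) (Q : mdyck m) : mdyck m :=
  cat_at P (cmin m i P) Q.

(* The inner match separates r = 1 from r > 1; by prime_factors_neq0 the last *)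
(* branch is never taken.                                                     *)
Definition backslash_path m (P : mdyck m) (i : nat) (Q : mdyck m) : mdyck m :=
  if prime_factors Q is Q1 :: Qs then
    let P' := if belast Q1 Qs is R1 :: Rs then cat_at P (L P) (concat0 R1 Rs)
              else P in
    cat_at P' (cmax m i P) (last Q1 Qs)
  else P.

(* Y = X_(d) for a down step d of X, at position k, followed by an up step.   *)
Definition tamari_cover (m : nat) (X Y : path_word) : bool :=
  has (fun k => [&& nth up X k == dn, nth dn X k.+1 == up &
         let Xu := excursion m (drop k.+1 X) in
         Y == take k X ++ Xu ++ dn :: drop (k.+1 + size Xu) X])
      (iota 0 (size X)).

(* The path X_(d) is again an m-Dyck path of the size of X, so restricting    *)
(* the covers to Dy m n loses none.                                           *)
Definition tamari m n : rel (Dy m n) :=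
  connect (fun X Y : Dy m n => tamari_cover m X Y).

(* Words as trajectories, and the properties of the operations above.         *)

Fixpoint run (m h : nat) (w : path_word) : option nat :=
  match w with
  | [::] => Some h
  | up :: w' => run m (h + m) w'
  | dn :: w' => if h is h'.+1 then run m h' w' else None
  end.

Lemma run_cat m h u v : run m h (u ++ v) = obind (fun h' => run m h' v) (run m h u).
Proof. by elim: u h => [|[] u IH] [|h] //=; rewrite IH. Qed.

Lemma run_add m a h w h' : run m h w = Some h' -> run m (h + a) w = Some (h' + a).
Proof.
elim: w h => [|[] w IH] h /=; first by case=> ->.
  by move/IH; rewrite addnAC.
by case: h => // h /IH.
Qed.

Lemma run_nseq m h i : run m (h + i) (nseq i dn) = Some h.
Proof. by elim: i => [|i IH]; rewrite ?addn0 // addnS. Qed.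

Lemma all_iotaS (p : pred nat) n :
  all p (iota 0 n.+1) = p 0 && all (fun k => p k.+1) (iota 0 n).
Proof. by rewrite /= (iotaDl 1 0) all_map. Qed.

Lemma runE m h w : run m h w =
  if all (fun k => ndn (take k w) <= h + m * nup (take k w)) (iota 0 (size w).+1)
  then Some (h + m * nup w - ndn w) else None.
Proof.
elim: w h => [|s w IH] h; first by rewrite /= muln0 addn0 subn0.
rewrite all_iotaS [size (_ :: _)]/=; move et: (size w).+1 IH => t IH /=.
case: s => [|]; last case: h => [|h]; rewrite /= ?IH.
- set a := all _ _; set b := all _ _.
  have -> : a = b.
    by apply: eq_all => k; rewrite /= /nup /ndn /= add0n add1n mulnS addnA.
  by rewrite /nup /ndn /= add0n add1n mulnS addnA.
- by case: t et {IH} => //= t _; rewrite take0 /nup /ndn /= muln0.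
by rewrite /nup /ndn /= add0n add1n addSn subSS.
Qed.

Lemma is_mdyckE m w : is_mdyck m w = (run m 0 w == Some 0).
Proof.
rewrite /is_mdyck runE.
set a := all _ _.
case: (boolP a) => [al|]; last by rewrite andbF.
rewrite andbT.
have : ndn w <= m * nup w.
  by move/allP/(_ (size w)): al; rewrite take_size mem_iota /=; apply; lia.
by move=> le; apply/eqP/eqP => [->|[]]; rewrite ?add0n ?subnn //; lia.
Qed.

Lemma levels_from_cat k u v :
  levels_from k (u ++ v) = levels_from k u ++ levels_from (k + nup u) v.
Proof.
elim: u k => [|[] u IH] k /=; first by rewrite addn0.
  by rewrite IH /nup /= add1n addSnnS.
by rewrite IH.
Qed.

Lemma levels_from_nseq k i : levels_from k (nseq i dn) = nseq i k.
Proof. by elim: i => //= i ->. Qed.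

Lemma levels_from_bounds k w :
  all (fun j => k <= j <= k + nup w) (levels_from k w).
Proof.
elim: w k => [|[] w IH] k //=.
  by apply: sub_all (IH k.+1) => j; rewrite /nup /=; lia.
by rewrite leqnn leq_addr /=; apply: sub_all (IH k) => j.
Qed.

Lemma count_levels0 j k w :
  ~~ (k <= j <= k + nup w) -> count_mem j (levels_from k w) = 0.
Proof.
move=> nj; apply/count_memPn; apply: contra nj => jin.
exact: (allP (levels_from_bounds k w)).
Qed.

Lemma levels_from_shift a k w :
  levels_from (k + a) w = [seq j + a | j <- levels_from k w].
Proof. by elim: w k => [|[] w IH] k //=; rewrite -IH. Qed.

Lemma of_levels_cat a b : of_levels (a ++ b) = of_levels a ++ of_levels b.
Proof. by rewrite /of_levels map_cat flatten_cat. Qed.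

Lemma of_levels_from k w :
  w = nseq (count_mem k (levels_from k w)) dn ++
      of_levels [seq count_mem j (levels_from k w) | j <- iota k.+1 (nup w)].
Proof.
elim: w k => [|[] w IH] k //=.
  by rewrite count_levels0 ?ltnn //= {1}(IH k.+1) /of_levels /nup /=.
rewrite eqxx /= -[nup _]/(nup w) {1}(IH k); congr (_ :: _ ++ of_levels _).
apply/eq_in_map => j; rewrite mem_iota => /andP[kj _].
by rewrite (ltn_eqF kj).
Qed.

Lemma mdyckP m (P : mdyck m) : run m 0 P = Some 0.
Proof. by case: P => w /= /andP[]; rewrite is_mdyckE => /eqP. Qed.

Lemma mdyck_nup m (P : mdyck m) : 0 < nup P.
Proof. by case: P => w /= /andP[]. Qed.

Lemma mdyck_of_levels m (P : mdyck m) :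
  (P : path_word) = of_levels [seq L_ k P | k <- iota 1 (nup P).-1] ++ up :: nseq (L P) dn.
Proof.
rewrite {1}(of_levels_from 0 P).
have -> : count_mem 0 (levels_from 0 P) = 0.
  have := mdyckP P; have := mdyck_nup P.
  by case: (P : path_word) => [|[] w] //= _ _; rewrite count_levels0 ?ltnn.
rewrite -{1}(prednK (mdyck_nup P)) -[X in iota _ X]addn1 iotaD map_cat /=  of_levels_cat.
rewrite add1n prednK ?mdyck_nup //.
by rewrite /of_levels /= cats0.
Qed.

Lemma mdyck_tail m (P : mdyck m) i : i <= L P ->
  (P : path_word) = take (size P - i) P ++ nseq i dn.
Proof.
move=> le; rewrite -{1}(cat_take_drop (size P - i) P); congr (_ ++ _).
rewrite [X in drop _ X]mdyck_of_levels [X in size X]mdyck_of_levels.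
rewrite size_cat /= size_nseq drop_cat ltnNge.
have -> : size (of_levels [seq L_ k P | k <- iota 1 (nup P).-1]) + (L P).+1 - i
   = size (of_levels [seq L_ k P | k <- iota 1 (nup P).-1]) + (L P - i).+1 by lia.
rewrite leq_addr /= addKn /=.
by rewrite drop_nseq; congr nseq; lia.
Qed.

Lemma cat_wordE m (P Q : mdyck m) i : i <= L P ->
  cat_word P i Q = take (size P - i) P ++ Q ++ nseq i dn.
Proof.
move=> le; rewrite /cat_word -cat1s !of_levels_cat /= {4}(mdyck_of_levels Q).
have tl : up :: nseq (L P) dn = (up :: nseq (L P - i) dn) ++ nseq i dn.
  by rewrite cat_cons -nseqD subnK.
have -> : take (size P - i) P =
    of_levels [seq L_ k P | k <- iota 1 (nup P).-1] ++ up :: nseq (L P - i) dn.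
  set A := of_levels _; have eP : (P : path_word) = A ++ up :: nseq (L P) dn.
    exact: mdyck_of_levels.
  rewrite {2}eP tl catA take_cat [X in size X]eP tl catA size_cat size_nseq addnK.
  by rewrite ltnn subnn take0 cats0.
rewrite /of_levels /= !cats0 -!catA /=; congr (_ ++ _ :: _ ++ _ ++ _).
by rewrite nseqD.
Qed.

Lemma run_mdyck m h (Q : mdyck m) : run m h Q = Some h.
Proof. exact: (@run_add m h 0 Q 0 (mdyckP Q)). Qed.

Lemma run_tail m (P : mdyck m) i : i <= L P ->
  run m 0 (take (size P - i) P) = Some i.
Proof.
move=> /mdyck_tail e; have := mdyckP P; rewrite {1}e run_cat.
case: run => //= h; elim: i h {e} => [|i IH] [|h] //=.
by move/IH => [->].
Qed.

Lemma val_cat_at m (P Q : mdyck m) i : i <= L P ->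
  (cat_at P i Q : path_word) = cat_word P i Q.
Proof.
move=> le; rewrite /cat_at val_insubd is_mdyckE cat_wordE //.
rewrite !run_cat run_tail //= run_cat run_mdyck /=.
have /= -> := run_nseq m 0 i; rewrite eqxx /=.
by rewrite /nup !count_cat -/(nup Q) (leq_trans (mdyck_nup Q)) //; lia.
Qed.

Lemma nup_cat_at m (P Q : mdyck m) i : i <= L P ->
  nup (cat_at P i Q) = nup P + nup Q.
Proof.
move=> le; rewrite val_cat_at // cat_wordE // [X in _ = nup X + _](mdyck_tail le).
by rewrite /nup !count_cat !count_nseq; lia.
Qed.

Lemma L_cat_at m (P Q : mdyck m) i : i <= L P -> L (cat_at P i Q) = L Q + i.
Proof.
move=> le; rewrite /L /L_ nup_cat_at // val_cat_at // cat_wordE // /levels.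
have nt : nup (take (size P - i) P) = nup P.
  by rewrite [X in _ = nup X](mdyck_tail le) /nup count_cat count_nseq addn0.
rewrite !levels_from_cat levels_from_nseq !count_cat count_nseq /= !add0n nt.
rewrite count_levels0 ?nt; last by have := mdyck_nup Q; lia.
rewrite eqxx mul1n add0n; congr (_ + _).
rewrite -[X in levels_from X]add0n levels_from_shift count_map.
by apply: eq_count => j /=; rewrite addnC eqn_add2l.
Qed.

Lemma val_cat_at0 m (P Q : mdyck m) : (cat_at P 0 Q : path_word) = P ++ Q.
Proof. by rewrite val_cat_at // cat_wordE // subn0 take_size cats0. Qed.

Lemma val_concat0 m (Q1 : mdyck m) (Qs : seq (mdyck m)) :
  (concat0 Q1 Qs : path_word) = flatten (map (@mdyck_word m) (Q1 :: Qs)).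
Proof.
rewrite /concat0; elim: Qs Q1 => [|Q2 Qs IH] Q1 /=; first by rewrite cats0.
by rewrite IH /= val_cat_at0 catA.
Qed.

Lemma nup_concat0 m (Q1 : mdyck m) (Qs : seq (mdyck m)) :
  nup (concat0 Q1 Qs) = sumn [seq nup X | X : mdyck m <- Q1 :: Qs].
Proof.
rewrite val_concat0 /nup count_flatten -map_comp.
by congr sumn; apply: eq_map.
Qed.

(* The nonempty m-Dyck words without proper nonempty m-Dyck prefix.           *)
Definition irr m w := [&& is_mdyck m w, 0 < size w
  & all (fun k => ~~ is_mdyck m (take k w)) (iota 1 (size w).-1)].

Lemma irrP m w : reflect
  [/\ is_mdyck m w, 0 < size w & forall k, 0 < k < size w -> ~~ is_mdyck m (take k w)]
  (irr m w).
Proof.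
apply: (iffP and3P) => -[d s H]; split=> //.
  move=> k lt; apply: (allP H); rewrite mem_iota; lia.
by apply/allP => k; rewrite mem_iota => lt; apply: H; lia.
Qed.

Lemma excursion_spec m w s : 0 < s <= size w -> is_mdyck m (take s w) ->
  exists2 k, excursion m w = take k w &
    0 < k <= s /\ is_mdyck m (take k w) /\
    (forall j, 0 < j < k -> ~~ is_mdyck m (take j w)).
Proof.
move=> ss ds; rewrite /excursion; set p := fun k => is_mdyck _ _.
have hp : has p (iota 1 (size w)).
  by apply/hasP; exists s => //; rewrite mem_iota; lia.
have ltf := hp; rewrite has_find size_iota in ltf.
have bf := @before_find _ 0 p (iota 1 (size w)); have := nth_find 0 hp.
move: (find _ _) ltf bf => f ltf bf; rewrite nth_iota // => pf.
have {}bf k : 0 < k -> k <= f -> ~~ is_mdyck m (take k w).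
  move=> k0 kf; have := bf k.-1; rewrite nth_iota; last by lia.
  by rewrite add1n prednK // /p => ->; lia.
exists f.+1 => //; split; last by split=> // j /andP[]; exact: bf.
rewrite /= ltnNge; apply/negP => sf.
by have := bf s; rewrite ds => H; suff: false by []; apply: H => //; lia.
Qed.

Lemma excursion_cat m p r : irr m p -> excursion m (p ++ r) = p.
Proof.
case/irrP => d s H.
have [||k -> [/andP[k0 ks] [dk _]]] := @excursion_spec m (p ++ r) (size p).
- by rewrite s size_cat leq_addr.
- by rewrite take_size_cat.
have e : take k (p ++ r) = take k p by rewrite takel_cat.
rewrite e in dk *.
have : ~~ (k < size p) by apply/negP => lt; have := H k; rewrite k0 lt dk => /(_ isT).
by rewrite -leqNgt => /take_oversize.
Qed.

Lemma excursionP m w : is_mdyck m w -> 0 < size w ->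
  [/\ irr m (excursion m w),
      excursion m w ++ drop (size (excursion m w)) w = w
    & is_mdyck m (drop (size (excursion m w)) w)].
Proof.
move=> d s; have [||k e [/andP[k0 ks] [dk H]]] := @excursion_spec m w (size w).
- by rewrite s leqnn.
- by rewrite take_size.
have ek : size (take k w) = k by rewrite size_take_min; lia.
rewrite e ek cat_take_drop; split=> //.
  apply/irrP; rewrite ek; split=> // j /andP[j0 jk].
  by rewrite -take_min (minn_idPl (ltnW jk)) H // j0.
move: d dk; rewrite !is_mdyckE -{1}(cat_take_drop k w) run_cat.
by move=> + /eqP ek0; rewrite ek0.
Qed.

Lemma factor_words_irr m f ws : all (irr m) ws -> size (flatten ws) <= f ->
  factor_words m f (flatten ws) = ws.
Proof.
elim: ws f => [|w ws IH] [|f] //= /andP[iw iws].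
  by case/irrP: iw => _ s _; rewrite size_cat; lia.
case/irrP: (iw) => _ s _; rewrite size_cat => le.
have -> (T : Type) (a b : T) : (if w ++ flatten ws is [::] then a else b) = b.
  by case: (w) s.
rewrite excursion_cat // drop_size_cat // IH //; lia.
Qed.

Lemma factor_words_flatten m f w : is_mdyck m w -> size w <= f ->
  flatten (factor_words m f w) = w /\ all (irr m) (factor_words m f w).
Proof.
elim: f w => [|f IH] w d; first by case: w d.
case: (posnP (size w)) => [/size0nil -> //|s] le /=.
have [i e dr] := excursionP d s.
have -> (T : Type) (a b : T) : (if w is [::] then a else b) = b by case: (w) s.
have [|fl al] := IH _ dr; last by rewrite /= fl e i al.
by case/irrP: i => _ se _; rewrite size_drop; lia.
Qed.

Lemma is_mdyck_nup m w : is_mdyck m w -> 0 < size w -> 0 < nup w.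
Proof. by rewrite -nup_ndn => /andP[/eqP -> _]; case: nup; rewrite ?muln0. Qed.

Lemma mdyck_size m (P : mdyck m) : 0 < size (P : path_word).
Proof. by rewrite -nup_ndn ltn_addr ?mdyck_nup. Qed.

Lemma mdyck_dyck m (P : mdyck m) : is_mdyck m P.
Proof. by rewrite is_mdyckE mdyckP. Qed.

Lemma prime_pathP m (P : mdyck m) : prime_path P <-> irr m P.
Proof.
split=> [pP|/irrP[d s H] Q R e]; last first.
  have eP : (P : path_word) = Q ++ R by rewrite e val_cat_at0.
  have := H (size (Q : path_word)).
  rewrite eP size_cat take_size_cat // mdyck_dyck.
  by have := mdyck_size Q; have := mdyck_size R; lia.
have [i e dr] := excursionP (mdyck_dyck P) (mdyck_size P).
case: (posnP (size (drop (size (excursion m P)) P))) => [/size0nil e0|sd].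
  by move: e i; rewrite e0 cats0 => ->.
case/irrP: i => di si _.
have wi : is_mdyck m (excursion m P) && (0 < nup (excursion m P)).
  by rewrite di (is_mdyck_nup di).
have wd : is_mdyck m (drop (size (excursion m P)) P) &&
    (0 < nup (drop (size (excursion m P)) P)).
  by rewrite dr (is_mdyck_nup dr).
by case: (pP (MDyck wi) (MDyck wd)); apply: val_inj; rewrite /= val_cat_at0.
Qed.

Lemma map_prime_factors m (Q : mdyck m) :
  map (@mdyck_word m) (prime_factors Q) = factor_words m (size (Q : path_word)) Q.
Proof.
have [_ al] := factor_words_flatten (mdyck_dyck Q) (leqnn _).
rewrite /prime_factors; elim: factor_words al => //= w ws IH /andP[/irrP[d s _] al].
by rewrite insubT ?d ?(is_mdyck_nup d) //= => p; rewrite IH.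
Qed.

Lemma prime_factors_neq0 m (Q : mdyck m) : prime_factors Q <> [::].
Proof.
move=> e; have [fl _] := factor_words_flatten (mdyck_dyck Q) (leqnn _).
by have := mdyck_size Q; rewrite -fl -map_prime_factors e.
Qed.

Lemma prime_factorsP m (Q Q1 : mdyck m) (Qs : seq (mdyck m)) :
  prime_factors Q = Q1 :: Qs <->
  (forall X, X \in Q1 :: Qs -> prime_path X) /\ concat0 Q1 Qs = Q.
Proof.
have [fl al] := factor_words_flatten (mdyck_dyck Q) (leqnn _).
split=> [e|[pr e]].
  rewrite -map_prime_factors e in fl al; split.
    by move=> X Xin; apply/prime_pathP/(allP al)/map_f.
  by apply: val_inj; rewrite [LHS]val_concat0 fl.
apply: (inj_map val_inj); rewrite [LHS]map_prime_factors.
rewrite -e val_concat0 factor_words_irr //.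
by apply/allP => _ /mapP[X Xin ->]; apply/prime_pathP/pr.
Qed.

Lemma exact_max_bounds m i P : (cmin m i P <= L P) && (cmax m i P <= L P).
Proof.
have al : all (fun c => c <= L P) (admissible m i P).
  by apply/allP => c; rewrite mem_filter mem_iota; lia.
rewrite /cmin /cmax; case: admissible al => //= c s /andP[le al]; rewrite le /=.
by move: (mem_last c s); rewrite inE => /predU1P[->|/(allP al)].
Qed.

Lemma nup_slash_path m (P : mdyck m) i (Q : mdyck m) :
  nup (slash_path P i Q) = nup P + nup Q.
Proof. by rewrite nup_cat_at //; case/andP: (exact_max_bounds m i P). Qed.

Lemma nup_backslash_path m (P : mdyck m) i (Q : mdyck m) :
  nup (backslash_path P i Q) = nup P + nup Q.
Proof.
have [_ le] := andP (exact_max_bounds m i P).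
rewrite /backslash_path; case e: prime_factors => [|Q1 Qs].
  by case: (prime_factors_neq0 e).
have [_ <-] := (prime_factorsP Q Q1 Qs).1 e; rewrite nup_concat0 /= {e}.
case/lastP: Qs => [|Qs Qr]; first by rewrite /= nup_cat_at // addn0.
rewrite belast_rcons last_rcons nup_cat_at ?L_cat_at ?nup_cat_at //; last first.
  by rewrite (leq_trans le) ?leq_addl.
by rewrite nup_concat0 map_rcons -cats1 sumn_cat /= addn0 !addnA.
Qed.

Lemma last_mdyck_prefix m p r : is_mdyck m p ->
  last 0 [seq k <- iota 0 (size (p ++ dn :: r)).+1 | is_mdyck m (take k (p ++ dn :: r))]
    = size p.
Proof.
move=> d; rewrite size_cat -addSn iotaD filter_cat add0n.
rewrite [X in _ ++ X](_ : _ = [::]) ?cats0.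
  by rewrite -[(size p).+1]addn1 iotaD /= filter_cat /= add0n take_size_cat // d last_cat.
apply/eqP; rewrite -(negbK (_ == _)) -has_filter; apply/hasPn => k.
rewrite mem_iota => /andP[lt _].
rewrite take_cat ltnNge (ltnW lt) /= -(subnSK lt) /= is_mdyckE run_cat.
by move: d; rewrite is_mdyckE => /eqP ->.
Qed.

Lemma glue_cons (T : Type) (x : T) (s t : seq T) (ss : seq (seq T)) :
  glue x (s :: t :: ss) = s ++ x :: glue x (t :: ss).
Proof. by []. Qed.

Lemma split_dn_glue m j Ps : size Ps = j.+1 -> all (is_mdyck m) Ps ->
  split_dn m j (glue dn Ps) = Ps.
Proof.
elim: j Ps => [|j IH] [|P [|P' Ps]] //=; first by rewrite /glue /= cats0.
move=> [sz] /andP[d al]; rewrite glue_cons last_mdyck_prefix // take_size_cat //.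
by rewrite -addn1 addnC -drop_drop drop_size_cat //= drop0 IH //= sz.
Qed.

Lemma size_split_dn m j w : all (fun P => size P <= size w) (split_dn m j w).
Proof.
elim: j w => [|j IH] w /=; first by rewrite leqnn.
rewrite size_take_min geq_minr /=; apply: sub_all (IH _) => P.
by rewrite size_drop; lia.
Qed.

Lemma color_node_ext r1 r2 Ps : (forall P, P \in Ps -> r1 P = r2 P) ->
  color_node r1 Ps = color_node r2 Ps.
Proof.
move=> H; congr glue; apply/eq_in_map => j; rewrite mem_iota => /andP[_ lt].
by rewrite H // mem_nth.
Qed.

Lemma coloring_fuel m f w : size w <= f -> coloring_rec m f w = coloring m w.
Proof.
rewrite /coloring; have [n] := ubnP (size w).
elim: n w f => // n IH [|s w] [|f] //= lt le.
apply: color_node_ext => P Pin.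
have := allP (size_split_dn m m w) _ Pin => szP.
rewrite IH ?[RHS]IH //; lia.
Qed.

(* The recursion defining the standard coloring, for P = u P_0 d ... d P_m.   *)
Lemma coloring_node m Ps : size Ps = m.+1 -> all (is_mdyck m) Ps ->
  coloring m (up :: glue dn Ps) = color_node (coloring m) Ps.
Proof.
move=> sz al; rewrite /coloring /= split_dn_glue //.
apply: color_node_ext => P Pin; apply: coloring_fuel.
by have := allP (size_split_dn m m (glue dn Ps)) P; rewrite split_dn_glue //; apply.
Qed.

Lemma glue_cat_size (T : Type) (x : T) ss1 ss2 : 0 < size ss1 ->
  glue x (ss1 ++ ss2) = glue x ss1 ++ flatten [seq x :: s | s <- ss2].
Proof. by case: ss1 => // s ss1 _; rewrite /glue map_cat flatten_cat. Qed.

Lemma run_glue m Ps : all (is_mdyck m) Ps -> run m (size Ps).-1 (glue dn Ps) = Some 0.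
Proof.
elim: Ps => [|P [|P' Ps] IH] //= /andP[d al].
  by move: d; rewrite /glue /= cats0 is_mdyckE => /eqP.
rewrite glue_cons run_cat.
move: d; rewrite is_mdyckE => /eqP /(run_add (size Ps).+1) -> /=.
by rewrite IH.
Qed.

Lemma run_glue_ex m j w : run m j w = Some 0 ->
  exists Ps, [/\ size Ps = j.+1, all (is_mdyck m) Ps & w = glue dn Ps].
Proof.
elim: w j => [|[] w IH] j /=.
- by case=> ->; exists [:: [::]]; rewrite /= is_mdyckE.
- case/IH => Ps [sz al ->].
  have szt : size (take m.+1 Ps) = m.+1 by rewrite size_take_min sz; lia.
  exists ((up :: glue dn (take m.+1 Ps)) :: drop m.+1 Ps); split.
  + by rewrite /= size_drop sz; lia.
  + rewrite -(cat_take_drop m.+1 Ps) all_cat in al; case/andP: al => al1 al2.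
    by rewrite /= al2 andbT is_mdyckE /= add0n; have := run_glue al1; rewrite szt => ->.
  + by rewrite -{1}(cat_take_drop m.+1 Ps) glue_cat_size ?szt.
case: j => // j /IH [Ps [sz al ->]]; exists ([::] :: Ps).
by rewrite /= sz is_mdyckE /= al; split=> //; case: Ps sz {al}.
Qed.

(* Every m-Dyck path of size at least 1 is of the form u P_0 d ... d P_m.     *)
Lemma mdyck_node m (P : mdyck m) : exists Ps,
  [/\ size Ps = m.+1, all (is_mdyck m) Ps & (P : path_word) = up :: glue dn Ps].
Proof.
have := mdyckP P; have := mdyck_nup P.
case: (P : path_word) => [|[] w] //= _; rewrite add0n => /run_glue_ex [Ps [sz al ->]].
by exists Ps.
Qed.

Fact slash_subproof m n1 n2 (P : Dy m n1) i (Q : Dy m n2) :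
  nup (slash_path P i Q) == n1 + n2.
Proof. by rewrite nup_slash_path (eqP (valP P)) (eqP (valP Q)). Qed.

Fact backslash_subproof m n1 n2 (P : Dy m n1) i (Q : Dy m n2) :
  nup (backslash_path P i Q) == n1 + n2.
Proof. by rewrite nup_backslash_path (eqP (valP P)) (eqP (valP Q)). Qed.

Definition slash m n1 n2 (P : Dy m n1) (i : nat) (Q : Dy m n2) : Dy m (n1 + n2) :=
  DyckOfSize (slash_subproof P i Q).

Definition backslash m n1 n2 (P : Dy m n1) (i : nat) (Q : Dy m n2) : Dy m (n1 + n2) :=
  DyckOfSize (backslash_subproof P i Q).

(* Main.v *)
Require Import Defs.
From mathcomp Require Import all_boot all_order all_algebra.
From mathcomp Require Import zify.

(** Write P as [stem P] followed by its L = L(P) final down steps. Put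
    t_j = lambda_j + ... + lambda_r. Then P *_lambda Q is the word

      stem P  d^(L - t_1)  Q_1  d^(t_1 - t_2)  Q_2  ...  Q_r  d^(t_r),

    called [stem P ++ interleave L [:: t_1; ...; t_r] Qs] below, and lambda
    corresponds bijectively to the chain L >= t_1 >= ... >= t_r, whose last
    term is lambda_r. The two bounds of the interval are the interleavings of
    the chains (c, ..., c) and (L, ..., L, C), where c = c_i(P), C = C_i(P).
    The theorem then has three ingredients.

    First, lambda lies in Lambda_r^i(P) exactly when c <= lambda_r <= C
    ([exact_maxE]): the multiplicities of colors in a final segment of
    omega_n^P grow with the segment, so the admissible lengths form an interval;
    they grow by at most one at a time, and the color n reaches multiplicity m
    among the down steps of level n, so that every i <= m is attained.

    Second, interleavings are increasing in the chain ([tamari_interleave]):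
    as Q_j is the excursion of its first step, moving one of the inserted down
    steps from the left of Q_j to its right is a covering relation. Hence every
    chain between (c, ..., c) and (L, ..., L, C) gives a path in the interval.

    Third, the interval contains nothing else ([interval_words]). A cover raises
    the path, so the Tamari order implies the pointwise order of paths
    ([tamari_dominated]); as both bounds begin with [stem P], so does every Z
    in between. In the rest of Z, erase the down steps that belong to P, which
    are those reaching a new minimum of the height. A cover
    that moves a step of P does not change what remains, and any other one
    becomes a cover of the remaining words, so the remaining word also increases
    ([tamari_inner]). At both bounds it is Q, hence it is Q for Z as well, and
    Z is an interleaving. Finally, the number of trailing down steps is monotone
    for the pointwise order, which puts the last term of the chain of Z between
    c and C. *)

Set Implicit Arguments.
Unset Strict Implicit.
Unset Printing Implicit Defensive.

#[local] Arguments nup : simpl never.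

(** * The pointwise order of paths *)

Lemma nup_cons b w : nup (b :: w) = b + nup w.
Proof. by rewrite /nup /=; case: b. Qed.

Lemma nup_cat u v : nup (u ++ v) = nup u + nup v.
Proof. by rewrite /nup count_cat. Qed.

Lemma nup_nseq_dn l : nup (nseq l dn) = 0.
Proof. by rewrite /nup count_nseq. Qed.

Definition dominated (X Y : path_word) : Prop :=
  size X = size Y /\ forall k, nup (take k X) <= nup (take k Y).

Lemma dominated_trans X Y Z : dominated X Y -> dominated Y Z -> dominated X Z.
Proof.
move=> [sXY XY] [sYZ YZ]; split=> [|k]; first by rewrite sXY.
exact: leq_trans (XY k) (YZ k).
Qed.

Lemma eq_take_nup X Y n : n <= size X -> n <= size Y ->
  (forall k, k <= n -> nup (take k X) = nup (take k Y)) -> take n X = take n Y.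
Proof.
elim: n => [|n IH] lX lY H; first by rewrite !take0.
have e : take n X = take n Y by apply: IH => [||k kn]; [lia | lia | apply: H; lia].
have := H n.+1 (leqnn _); rewrite !(take_nth dn) // -!cats1 !nup_cat e !nup_cons.
by case: nth; case: nth; rewrite /nup /=; lia || by [].
Qed.

(** Two paths with the same prefix [a] have the same height throughout [a], which
    leaves no freedom for a path between them. *)
Lemma dominated_squeeze a x y Z :
  dominated (a ++ x) Z -> dominated Z (a ++ y) -> exists z, Z = a ++ z.
Proof.
move=> [sX X] [sY Y]; exists (drop (size a) Z).
rewrite -{1}(cat_take_drop (size a) Z); congr (_ ++ _).
rewrite -[RHS](take_size_cat x (erefl (size a))); apply: eq_take_nup.
- by rewrite -sX size_cat leq_addr.
- by rewrite size_cat leq_addr.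
move=> k ka; apply/eqP; rewrite eqn_leq X andbT.
by have := Y k; rewrite !takel_cat.
Qed.

Lemma dominated_anti X Y : dominated X Y -> dominated Y X -> X = Y.
Proof.
move=> dXY dYX; have := dYX; rewrite -[X]cats0 => dYX0.
have := dXY; rewrite -[X]cats0 => dXY0.
have [z e] := dominated_squeeze dXY0 dYX0.
case: dXY; rewrite e size_cat; case: z {e dXY0 dYX0 dYX} => [|b z] /=; last by lia.
by rewrite !cats0.
Qed.

Lemma dominated_catl p X Y : dominated X Y -> dominated (p ++ X) (p ++ Y).
Proof.
move=> [s d]; split=> [|k]; first by rewrite !size_cat s.
by rewrite !take_cat; case: ifP => // _; rewrite !nup_cat leq_add2l.
Qed.

(** The content of a covering relation: the part [x] is raised and shifted one
    position to the left. *)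
Lemma dominated_push x s : dominated (dn :: x ++ s) (x ++ dn :: s).
Proof.
split=> [|k]; first by rewrite /= !size_cat /= addnS.
elim: x k => [|b x IH] [|k] //=; have := IH k; rewrite !nup_cons /=.
case: k => [|k] //=; rewrite !nup_cons; lia.
Qed.

(** A higher path has its last up step no later, so the order of paths controls
    the number of trailing down steps. *)
Lemma dominated_tail a b l l' : nup a = nup b ->
  dominated (a ++ up :: nseq l dn) (b ++ up :: nseq l' dn) -> l <= l'.
Proof.
move=> e [s /(_ (size b))]; rewrite [take _ (b ++ _)]take_size_cat // leqNgt => H.
rewrite leqNgt; apply: contra H => lt; move: s; rewrite !size_cat /= !size_nseq => s.
(* Otherwise the lower path has all its up steps before the last one of the
   higher path. *)
rewrite take_cat ifF; last by lia.
rewrite nup_cat e -addn1 leq_add2l (_ : size b - size a = (size b - size a).-1.+1); last by lia.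
by rewrite /= nup_cons.
Qed.

(** * Covering relations of the m-Tamari order *)

(** The covering relation without reference to positions. The irreducible words
    are the excursions, by [excursion_cat]. *)
Definition tamari_step m (X Y : path_word) : Prop :=
  exists p x s, [/\ X = p ++ dn :: x ++ s, Y = p ++ x ++ dn :: s & irr m x].

Lemma irr_up m x : irr m x -> exists y, x = up :: y.
Proof.
by case/irrP; rewrite is_mdyckE; case: x => [|[] y] //= _ _ _; exists y.
Qed.

(** The suffix comes down to height 0, hence below its starting height or, if
    [h = 0], back to it: cutting it at its new minima as [W_0 d W_1 d ...], the
    word [W_0] is nonempty and already contains the excursion. *)
Lemma excursion_up m h w : run m h (up :: w) = Some 0 ->
  irr m (excursion m (up :: w)) /\
  exists s, up :: w = excursion m (up :: w) ++ s.
Proof.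
move=> /run_glue_ex [[|W Ws] [sz al e]] //; case/andP: al => dW _ {sz}.
have sW : 0 < size W by case: W Ws {dW} e => [|? ?] // [|? ?].
have [iW eW _] := excursionP dW sW.
have -> : up :: w = excursion m W ++ drop (size (excursion m W)) W
            ++ flatten [seq dn :: s | s <- Ws].
  by rewrite catA eW e.
by rewrite excursion_cat //; split=> //; eexists.
Qed.

Lemma tamari_coverP m X Y : is_mdyck m X ->
  tamari_cover m X Y <-> tamari_step m X Y.
Proof.
move=> dX; split.
  case/hasP => k _ /and3P[/eqP e1 /eqP e2 /eqP ->].
  have k1 : k.+1 < size X by rewrite ltnNge; apply/negP => /(nth_default dn); rewrite e2.
  have eX : X = take k X ++ dn :: up :: drop k.+2 X.
    by rewrite -e2 -drop_nth // -e1 -(drop_nth up) ?cat_take_drop //; lia.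
  have : exists h, run m h (up :: drop k.+2 X) = Some 0.
    move: dX; rewrite is_mdyckE {1}eX run_cat; case: run => //= -[|h] //= /eqP.
    by exists h.
  have ed : drop k.+1 X = up :: drop k.+2 X by rewrite (drop_nth dn) ?e2.
  case=> h /excursion_up [ir [s es]]; rewrite ed.
  exists (take k X), (excursion m (up :: drop k.+2 X)), s; split=> //.
    by rewrite -es.
  congr (_ ++ _ ++ dn :: _); rewrite addnC -drop_drop ed {2}es.
  by rewrite drop_size_cat.
case=> p [x [s [eX -> ir]]]; apply/hasP; exists (size p).
  by rewrite mem_iota eX size_cat /=; lia.
have [y ey] := irr_up ir.
have eD : drop (size p).+1 X = x ++ s.
  by rewrite eX -cat_rcons drop_size_cat ?size_rcons.
apply/and3P; split.
- by rewrite eX nth_cat ltnn subnn.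
- by rewrite -[(size p).+1]addn0 -nth_drop eD ey.
rewrite /= eD excursion_cat // addnC -drop_drop eD drop_size_cat //.
by rewrite eX take_size_cat.
Qed.

Lemma tamari_step_dominated m X Y : tamari_step m X Y -> dominated X Y.
Proof. by move=> [p [x [s [-> -> _]]]]; apply/dominated_catl/dominated_push. Qed.

Lemma tamari_step_ind m n (R : Dy m n -> Dy m n -> Prop) :
  (forall X, R X X) ->
  (forall X Y Z : Dy m n, tamari_step m X Y -> tamari Y Z -> R Y Z -> R X Z) ->
  forall X Y, tamari X Y -> R X Y.
Proof.
move=> R0 R1 X Y /connectP [p]; elim: p X => [|Z p IH] X /= => [_ -> //|].
case/andP=> XZ pZ eY; apply: (R1 X Z); last exact: IH.
  by apply/tamari_coverP => //; apply: mdyck_dyck.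
by apply/connectP; exists p.
Qed.

Lemma tamari_dominated m n (X Y : Dy m n) : tamari X Y -> dominated X Y.
Proof.
move: X Y; apply: tamari_step_ind => // X Y Z /tamari_step_dominated XY _.
exact: dominated_trans.
Qed.

(** Moving a whole block of down steps across a prime path is a chain of covers;
    the intermediate words are again m-Dyck paths of the same size. *)
Lemma tamari_push m n (X : Dy m n) p a q s : irr m q ->
  (X : path_word) = p ++ nseq a dn ++ q ++ s ->
  exists2 Y : Dy m n, tamari X Y & (Y : path_word) = p ++ q ++ nseq a dn ++ s.
Proof.
move=> iq; elim: a X s => [|a IH] X s eX; first by exists X => //; exact: connect0.
have eS : nseq a.+1 dn = nseq a dn ++ [:: dn].
  by rewrite -[[:: dn]]/(nseq 1 dn) -nseqD addn1.
have eX' : (X : path_word) = (p ++ nseq a dn) ++ dn :: q ++ s.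
  by rewrite eX eS -!catA.
set w := (p ++ nseq a dn) ++ q ++ dn :: s.
have step : tamari_step m X w by exists (p ++ nseq a dn), q, s.
have rq : forall k, run m k q = Some k.
  by case/irrP: iq; rewrite is_mdyckE => /eqP rq _ _ k; exact: @run_add m k 0 q 0 rq.
have rw : run m 0 w = Some 0.
  have := mdyckP X; rewrite eX' /w !(run_cat m 0 (p ++ nseq a dn)); case: run => //= -[|h] //=.
  by rewrite !run_cat !rq.
have nw : nup w = n.
  rewrite -(eqP (valP X)) /= eX' /w !nup_cat !nup_cons !nup_cat; lia.
have dw : is_mdyck m w && (0 < nup w).
  by rewrite is_mdyckE rw eqxx nw -(eqP (valP X)) mdyck_nup.
have nY : nup (MDyck dw) == n by rewrite /= nw.
have [|Y' XY eY] := IH (DyckOfSize nY) (dn :: s); first by rewrite /= /w -!catA.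
exists Y'; last by rewrite eY eS -!catA.
apply: connect_trans XY; apply: connect1.
by apply/tamari_coverP => //; apply: mdyck_dyck.
Qed.

(** * Colors of the down steps of last level *)

(** Generalizes [color_node] (the case [o = 1]) so that the colors of
    [P_j d ... d P_m] are again of this form, with [o] increased by the number
    of up steps already read. *)
Definition color_shift (o : nat) (cl : path_word -> seq nat) (Ps : seq path_word) :=
  glue 1 [seq [seq c + sumn [seq nup P | P <- take j Ps] + o
                 | c <- cl (nth [::] Ps j)]
            | j <- iota 0 (size Ps)].

Lemma color_shift1 o cl P : color_shift o cl [:: P] = [seq c + o | c <- cl P].
Proof.
by rewrite /color_shift /glue /= cats0; apply: eq_map => c; rewrite addn0.
Qed.

Lemma color_shift_cons o cl P P' Ps :
  color_shift o cl (P :: P' :: Ps) =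
  [seq c + o | c <- cl P] ++ 1 :: color_shift (o + nup P) cl (P' :: Ps).
Proof.
have e : iota 0 (size (P :: P' :: Ps)) =
    0 :: [seq 1 + j | j <- iota 0 (size (P' :: Ps))] by rewrite -(iotaDl 1 0).
rewrite /color_shift e map_cons -map_comp /= glue_cons.
congr (_ ++ 1 :: glue _ (_ :: _)).
- by apply: eq_map => c; rewrite addn0.
- by apply: eq_map => c; lia.
- by apply: eq_map => j /=; apply: eq_map => c; rewrite add0n; lia.
Qed.

Definition level_color m w := zip (levels w) (coloring m w).

(** Both the level and the color of a down step inside P_j are its own ones within
    P_j plus the number of preceding up steps. The last up step lies in the last
    nonempty P_j, where its color occurs m times by hypothesis; if all P_j are
    empty, it is the root, whose color labels the separators. *)
Lemma level_color_glue m o (Ps : seq path_word) : 0 < size Ps ->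
  (forall P : path_word, P \in Ps -> size (coloring m P) = size (levels P) /\
     (0 < nup P -> m <= count_mem (nup P, nup P) (level_color m P))) ->
  let n := o + nup (glue dn Ps) in
  let lc := zip (levels_from o (glue dn Ps)) (color_shift o (coloring m) Ps) in
  [/\ size (color_shift o (coloring m) Ps) = size (levels_from o (glue dn Ps)),
      o < n -> m <= count_mem (n, n) lc
    & n = o -> (size Ps).-1 <= count_mem (o, 1) lc].
Proof.
have shiftl o' w : levels_from o' w = [seq l + o' | l <- levels w].
  by rewrite -levels_from_shift.
have shift_count a b o' s t : count_mem (a + o', b + o')
    (zip [seq l + o' | l <- s] [seq c + o' | c <- t]) = count_mem (a, b) (zip s t).
  by elim: s t => [|l s IHs] [|c t] //=; rewrite IHs !xpair_eqE !eqn_add2r.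
elim: Ps o => [|P [|P' Ps] IH] o //= _ H.
  have [sP cP] := H P (mem_head _ _).
  rewrite color_shift1 /glue /= cats0 shiftl !size_map sP; split=> // lt.
  by rewrite addnC shift_count cP; lia.
have [sP cP] := H P (mem_head _ _).
have {}H (P0 : path_word) : P0 \in P' :: Ps -> size (coloring m P0) = size (levels P0) /\
     (0 < nup P0 -> m <= count_mem (nup P0, nup P0) (level_color m P0)).
  by move=> Pin; apply: H; rewrite inE Pin orbT.
have /= [|s1 c1 d1] := IH (o + nup P) _ H => //.
rewrite glue_cons color_shift_cons levels_from_cat /= shiftl nup_cat nup_cons add0n.
have szE : size [seq l + o | l <- levels P] = size [seq c + o | c <- coloring m P].
  by rewrite !size_map sP.
rewrite zip_cat // !count_cat /=; split.
- by rewrite !size_cat /= szE !size_map s1.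
- case: (posnP (nup (glue dn (P' :: Ps)))) => [e|lt] ltn; last first.
    by rewrite !addnA (leq_trans (c1 _)) ?leq_addl // -[X in X < _]addn0 ltn_add2l.
  rewrite e addn0 [o + nup P]addnC shift_count (leq_trans (cP _)) ?leq_addr //.
  by rewrite e addn0 -[X in X < _]addn0 ltn_add2l in ltn.
move=> e; have [p0 g0] : nup P = 0 /\ nup (glue dn (P' :: Ps)) = 0.
  by move/eqP: e; rewrite -[X in _ == X]addn0 eqn_add2l addn_eq0 => /andP[/eqP -> /eqP ->].
move: d1; rewrite p0 g0 !addn0 => d1; rewrite eqxx addnCA add1n ltnS.
exact: leq_trans (d1 _) (leq_addl _ _).
Qed.

(** The m down steps matched with the last up step all follow it. *)
Lemma coloring_last_color m (P : mdyck m) :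
  size (coloring m P) = size (levels P) /\
  m <= count_mem (nup P, nup P) (level_color m P).
Proof.
have [n] := ubnP (size (P : path_word)); elim: n P => // n IH P ltn.
have [Ps [sz al e]] := mdyck_node P.
have colP : coloring m P = color_shift 1 (coloring m) Ps.
  by rewrite e coloring_node.
have [||s1 c1 d1] := @level_color_glue m 1 Ps; first by rewrite sz.
  move=> W Win; have dW := allP al W Win.
  case: (posnP (nup W)) => [nW|pW].
    by case: W {Win} dW nW => [|s W] // /is_mdyck_nup /(_ isT) + e0; rewrite e0.
  have wP : is_mdyck m W && (0 < nup W) by rewrite dW.
  have [|? ?] := IH (MDyck wP); last by split.
  apply: leq_ltn_trans (_ : size (glue dn Ps) < n); last by move: ltn; rewrite e.
  by have := size_split_dn m m (glue dn Ps); rewrite split_dn_glue // => /allP /(_ W Win).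
have nP : nup P = 1 + nup (glue dn Ps) by rewrite e /nup /=.
rewrite /level_color colP e /levels /=; split => //.
rewrite -[nup (up :: _)]/(1 + nup (glue dn Ps)).
case: (posnP (nup (glue dn Ps))) => [e0|lt]; last by apply: c1; lia.
by rewrite e0 addn0; have := d1 _; rewrite e0 sz; apply; lia.
Qed.

Lemma count_last_color_omega m (P : mdyck m) : m <= count_mem (nup P) (omega m P).
Proof.
have [_] := coloring_last_color P; rewrite /omega count_map count_filter.
by move/leq_trans; apply; apply: eq_leq; apply: eq_count => -[l c] /=; rewrite xpair_eqE andbC.
Qed.

Lemma size_omega m (P : mdyck m) : size (omega m P) <= L P.
Proof.
have [sz _] := coloring_last_color P.
rewrite /omega size_map size_filter /L /L_ -(count_map fst (pred1 (nup P))).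
by rewrite -/(unzip1 _) unzip1_zip // sz.
Qed.

Lemma count_last_letters_mono k c c' w : c <= c' ->
  count_mem k (last_letters c w) <= count_mem k (last_letters c' w).
Proof.
move=> le; rewrite /last_letters (_ : size w - c = (c' - c - (c' - size w)) + (size w - c')); last by lia.
rewrite -drop_drop -[X in _ <= count_mem k X](cat_take_drop (c' - c - (c' - size w))).
by rewrite count_cat leq_addl.
Qed.

Lemma count_last_letters_succ k c w :
  count_mem k (last_letters c.+1 w) <= (count_mem k (last_letters c w)).+1.
Proof.
rewrite /last_letters; case: (leqP (size w) c) => lt.
  by rewrite (_ : size w - c.+1 = size w - c); lia.
rewrite (_ : size w - c = (size w - c.+1).+1); last by lia.
rewrite (drop_nth 0) /=; last by lia.
by case: eqP => _; rewrite ?add1n ?add0n.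
Qed.

Lemma exact_max_convex m i P c1 c2 c : exact_max m i P c1 -> exact_max m i P c2 ->
  c1 <= c <= c2 -> exact_max m i P c.
Proof.
move=> /andP[_ /hasP[k kn /eqP ek]] /andP[/allP al _] /andP[le1 le2].
have bound j : j \in iota 1 (nup P) -> count_mem j (last_letters c (omega m P)) <= i.
  by move=> /al; apply: leq_trans; apply: count_last_letters_mono.
apply/andP; split; first exact/allP.
apply/hasP; exists k => //; rewrite eqn_leq bound // -{1}ek.
exact: count_last_letters_mono.
Qed.

(** At the least length where some multiplicity reaches [i], no multiplicity
    exceeds [i], as lengthening the segment by one letter adds at most one. *)
Lemma exact_max_attained m i P c :
  has (fun k => i <= count_mem k (last_letters c (omega m P))) (iota 1 (nup P)) ->
  exists2 c', c' <= c & exact_max m i P c'.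
Proof.
elim: c => [|c IH] H; last first.
  set reach := has (fun k => i <= count_mem k (last_letters c (omega m P)))
    (iota 1 (nup P)).
  case: (boolP reach) => [/IH[c' le e]|nreach]; first by exists c' => //; apply: leqW.
  have bound k : k \in iota 1 (nup P) ->
      count_mem k (last_letters c.+1 (omega m P)) <= i.
    move=> kn; have := count_last_letters_succ k c (omega m P).
    by have := hasPn nreach k kn; lia.
  exists c.+1 => //; apply/andP; split; first exact/allP.
  by case/hasP: H => k kn ge; apply/hasP; exists k => //; rewrite eqn_leq bound.
(* The empty segment reaches [i] only if [i = 0]. *)
exists 0 => //; move: H; rewrite /exact_max /last_letters subn0 drop_size /=.
case/hasP=> k kn; rewrite leqn0 => /eqP ->.
by apply/andP; split; [apply/allP | apply/hasP; exists k].
Qed.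

Lemma head_last_sorted s c : sorted leq s -> c \in s ->
  [/\ head 0 s <= c, c <= last 0 s, head 0 s \in s & last 0 s \in s].
Proof.
case: s => // a s so cs; split.
- move: so cs; rewrite /= inE => so /predU1P[->//|cs].
  by have /allP := order_path_min leq_trans so; apply.
- move: so cs; rewrite lastI (sorted_pairwise leq_trans) pairwise_rcons.
  by rewrite last_rcons => /andP[/allP H _]; rewrite mem_rcons inE => /predU1P[->//|/H].
- exact: mem_head.
- exact: mem_last.
Qed.

(** Admissibility is convex, and attained since the color n occurs m times. *)
Lemma exact_maxE m i (P : mdyck m) c : i <= m -> c <= L P ->
  exact_max m i P c = (cmin m i P <= c <= cmax m i P).
Proof.
move=> im cL; set s := admissible m i P.
have inE c' : (c' \in s) = exact_max m i P c' && (c' <= L P).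
  by rewrite mem_filter mem_iota.
have so : sorted leq s by apply: sorted_filter (iota_sorted _ _); exact: leq_trans.
have [|c' le' e'] := @exact_max_attained m i P (L P).
  apply/hasP; exists (nup P); first by rewrite mem_iota mdyck_nup add1n ltnS leqnn.
  rewrite /last_letters (_ : _ - _ = 0) ?drop0; last by have := size_omega P; lia.
  exact: leq_trans (count_last_color_omega P).
have [|_ _] := @head_last_sorted s c' so; first by rewrite inE e'.
rewrite !inE => /andP[e1 _] /andP[e2 _].
apply/idP/idP => [e|]; last exact: exact_max_convex.
by have [|-> -> _ _] := @head_last_sorted s c so; first by rewrite inE e.
Qed.

(** * Erasing the down steps that reach a new minimum *)

(** [h] is the height above the minimum reached so far; a down step at [h = 0]
    reaches a new minimum and is dropped. *)
Fixpoint inner_word m h w : path_word :=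
  match w with
  | [::] => [::]
  | up :: w' => up :: inner_word m (h + m) w'
  | dn :: w' => if h is h'.+1 then dn :: inner_word m h' w' else inner_word m 0 w'
  end.

Lemma inner_nseq m l w : inner_word m 0 (nseq l dn ++ w) = inner_word m 0 w.
Proof. by elim: l. Qed.

Lemma inner_cat m h h' x w : run m h x = Some h' ->
  inner_word m h (x ++ w) = x ++ inner_word m h' w.
Proof.
elim: x h => [|[] x IH] h /=; first by case=> ->.
  by move/IH => ->.
by case: h => // h /IH ->.
Qed.

(** If the moved down step is erased, both sides become equal, since [x] stays
    above its starting height. *)
Lemma inner_step m h p x s : run m 0 x = Some 0 ->
  dominated (inner_word m h (p ++ dn :: x ++ s)) (inner_word m h (p ++ x ++ dn :: s)).
Proof.
move=> rx; have rh k : run m k x = Some k := @run_add m k 0 x 0 rx.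
elim: p h => [|[] p IH] h /=.
- case: h => [|h]; rewrite !(inner_cat _ (rh _)) //=.
  exact: dominated_push.
- exact: (dominated_catl [:: up]).
- case: h => [|h]; first exact: IH.
  exact: (dominated_catl [:: dn]).
Qed.

(** Every path of a chain of covers from [X] to [Y] begins with the common prefix
    [a] by [dominated_squeeze], so each cover takes place after [a]. *)
Lemma tamari_inner m n (X Y : Dy m n) : tamari X Y -> forall a x y,
  (X : path_word) = a ++ x -> (Y : path_word) = a ++ y ->
  dominated (inner_word m 0 x) (inner_word m 0 y).
Proof.
move: X Y; apply: tamari_step_ind => [X a x y -> /eqP|X Y Z XY YZ IH a x z eX eZ].
  by rewrite eqseq_cat // eqxx /= => /eqP ->.
have [||y eY] := @dominated_squeeze a x z Y.
- by rewrite -eX; exact: tamari_step_dominated XY.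
- by rewrite -eZ; exact: tamari_dominated YZ.
apply: dominated_trans (IH a y z eY eZ).
case: XY => p [q [s [eX' eY' iq]]].
have [c ep] : exists c, p = a ++ c.
  have [u eu] := irr_up iq.
  (* At position [size p] one word has a down step and the other an up step. *)
  have le : size a <= size p.
    rewrite leqNgt; apply/negP => lt.
    have := congr1 (fun w => nth dn w (size p)) eY.
    have := congr1 (fun w => nth dn w (size p)) eX.
    by rewrite eX' eY' eu !nth_cat lt !ltnn subnn /= => <-.
  exists (drop (size a) p); rewrite -{1}(cat_take_drop (size a) p); congr (_ ++ _).
  have := congr1 (take (size a)) eX.
  by rewrite eX' [RHS]take_size_cat // takel_cat.
move: eX eY; rewrite eX' eY' ep -!catA => /eqP; rewrite eqseq_cat // eqxx /= => /eqP <-.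
move=> /eqP; rewrite eqseq_cat // eqxx /= => /eqP <-.
by apply: inner_step; case/irrP: iq; rewrite is_mdyckE => /eqP.
Qed.

(** As long as the height above the minimum is positive, nothing is erased. *)
Lemma inner_factor m h h' y v w :
  (forall k, k < size y -> exists2 g, 0 < g & run m h (take k y) = Some g) ->
  run m h y = Some h' -> inner_word m h w = y ++ v ->
  exists2 w', w = y ++ w' & inner_word m h' w' = v.
Proof.
elim: y h w => [|b y IH] h w pos; first by case=> <- e; exists w.
have h0 : 0 < h by have [g g0 [eh]] := pos 0 isT; rewrite eh.
case: h h0 pos => // h _ pos.
have {}pos k : k < size y -> exists2 g, 0 < g & run m h.+1 (b :: take k y) = Some g.
  exact: (pos k.+1).
by case: b pos => pos; case: w => [|[] w] //= ry [e];
  have [w' -> e'] := IH _ _ pos ry e; exists w'.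
Qed.

(** * Interleaving down steps with a sequence of paths *)

(** Indexed by the numbers [t] of down steps still to come rather than by the
    lengths of the blocks: the last block has length [last l s], and the
    inequalities [l >= t_1 >= t_2 >= ...] are written [path geq l s]. *)
Fixpoint interleave l (s : seq nat) (Qs : seq path_word) : path_word :=
  match s, Qs with
  | t :: s', Q :: Qs' => nseq (l - t) dn ++ Q ++ interleave t s' Qs'
  | _, _ => nseq l dn
  end.

Lemma interleave_nseq_cat l l' s Qs : path geq l s -> l <= l' ->
  nseq (l' - l) dn ++ interleave l s Qs = interleave l' s Qs.
Proof.
case: s => [|t s] /=; first by move=> _ le; rewrite -nseqD subnK.
case/andP=> tl _ le; case: Qs => [|Q Qs]; first by rewrite -nseqD subnK.
by rewrite catA -nseqD; congr (nseq _ dn ++ _); lia.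
Qed.

Lemma size_interleave l s Qs : path geq l s -> 
  size (interleave l s Qs) = l + size (flatten (take (size s) Qs)).
Proof.
elim: s l Qs => [|t s IH] l [|Q Qs] /=; rewrite ?size_nseq ?addn0 //.
by case/andP=> tl ps; rewrite !size_cat IH // size_nseq; lia.
Qed.

Lemma nup_interleave l s Qs : size s = size Qs ->
  nup (interleave l s Qs) = nup (flatten Qs).
Proof.
elim: s l Qs => [|t s IH] l [|Q Qs] //= => [|[sz]]; first by rewrite nup_nseq_dn.
by rewrite !nup_cat nup_nseq_dn IH.
Qed.

Lemma interleave_nseq l c Qs : 0 < size Qs ->
  interleave l (nseq (size Qs) c) Qs = nseq (l - c) dn ++ flatten Qs ++ nseq c dn.
Proof.
case: Qs => // Q Qs _ /=; rewrite -!catA; congr (_ ++ _ ++ _).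
by elim: Qs => [|Q' Qs IH] //=; rewrite subnn /= IH catA.
Qed.

Lemma interleave_rcons l c Qs Q :
  interleave l (rcons (nseq (size Qs) l) c) (rcons Qs Q)
    = flatten Qs ++ nseq (l - c) dn ++ Q ++ nseq c dn.
Proof. by elim: Qs => [|Q' Qs IH] //=; rewrite subnn /= IH catA. Qed.

Lemma interleave_last l s Qs : size s = size Qs -> 0 < size Qs ->
  exists b, interleave l s Qs = b ++ last [::] Qs ++ nseq (last l s) dn.
Proof.
elim: Qs l s => [|Q Qs IH] l [|a s] //= [sz] _.
case: Qs IH s sz => [|Q' Qs] IH [|a' s] //= sz.
  by exists (nseq (l - a) dn).
have [b eb] := IH a (a' :: s) sz isT.
by exists (nseq (l - a) dn ++ Q ++ b); rewrite -!catA -eb.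
Qed.

Lemma nseq_up_inj l l' v v' : nseq l dn ++ up :: v = nseq l' dn ++ up :: v' ->
  l = l' /\ v = v'.
Proof.
by elim: l l' => [|l IH] [|l'] //= [] // /IH [-> ->].
Qed.

(** A prime path begins with an up step, so the first block is the maximal run of
    leading down steps. *)
Lemma interleave_inj m l s t Qs : all (irr m) Qs ->
  path geq l s -> path geq l t -> size s = size Qs -> size t = size Qs ->
  interleave l s Qs = interleave l t Qs -> s = t.
Proof.
elim: Qs l s t => [|Q Qs IH] l [|a s] [|b t] //= /andP[iQ iQs].
move=> /andP[al ps] /andP[bl pt] [sz] [sz'] e.
have [y eQ] := irr_up iQ; move: e; rewrite eQ => /nseq_up_inj [eab /(congr1 (drop (size y)))].
rewrite !drop_size_cat // => e; have eb : a = b by lia.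
rewrite -eb in e pt *; congr (_ :: _); exact: IH e.
Qed.

Lemma inner_interleave m l s Qs : all (is_mdyck m) Qs -> size s = size Qs ->
  inner_word m 0 (interleave l s Qs) = flatten Qs.
Proof.
elim: s l Qs => [|t s IH] l [|Q Qs] //=.
  by move=> _ _; rewrite -[nseq l dn]cats0 inner_nseq.
case/andP; rewrite is_mdyckE => /eqP dQ al [sz].
by rewrite inner_nseq (inner_cat _ dQ) IH.
Qed.

Lemma leading_downs w : exists l w', w = nseq l dn ++ w' /\
  (w' = [::] \/ exists v, w' = up :: v).
Proof.
elim: w => [|[] w [l [w' [e H]]]]; first by exists 0, [::]; split; [|left].
  by exists 0, (up :: w); split; [|right; exists w].
by exists l.+1, w'; rewrite e.
Qed.

(** Down steps can only have been erased outside the prime factors: within a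
    factor the height above its start is positive until its last step. *)
Lemma inner_interleave_inv m Qs w : 0 < m -> all (irr m) Qs -> inner_word m 0 w = flatten Qs ->
  exists l s, [/\ size s = size Qs, path geq l s & w = interleave l s Qs].
Proof.
move=> m0; elim: Qs w => [|Q Qs IH] w /=.
  move=> _ e; have [l [w' [ew [e'|[v e']]]]] := leading_downs w.
    by exists l, [::]; rewrite /= ew e' cats0.
  by move: e; rewrite ew inner_nseq e'.
case/andP=> iQ iQs; have [l [w' [-> H]]] := leading_downs w; rewrite inner_nseq => e.
have [y eQ] := irr_up iQ; case/irrP: (iQ) => dQ _ pQ.
case: H => [e'|[v e']]; first by move: e; rewrite e' eQ.
(* [Q = up :: y] is prime, so no proper prefix of [y] comes down to its start. *)
have [] := @inner_factor m m 0 y (flatten Qs) v.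
- move=> k lt; have := pQ k.+1; rewrite eQ /= ltnS lt is_mdyckE => /(_ isT).
  move: dQ; rewrite is_mdyckE eQ -{1}(cat_take_drop k y) /= run_cat add0n.
  by case: run => // -[|g] // _ _; exists g.+1.
- by move: dQ; rewrite is_mdyckE eQ /= => /eqP.
- by move: e; rewrite e' eQ /= add0n => -[].
move=> w2 ev /IH [] // l2 [s2 [sz ps ew2]].
exists (l + l2), (l2 :: s2); rewrite /= sz leq_addl ps addnK e' ev eQ ew2; split=> //.
Qed.

(** The trailing down steps are those of the last factor, which is common to both
    sides, and the last block. *)
Lemma dominated_last b l s t Qs : size s = size Qs -> size t = size Qs ->
  0 < size Qs -> 0 < nup (last [::] Qs) ->
  dominated (b ++ interleave l s Qs) (b ++ interleave l t Qs) -> last l s <= last l t.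
Proof.
move=> sz sz' Q0 nQ; have ns := nup_interleave l sz; have nt := nup_interleave l sz'.
have [a [k ek]] : exists a k, last [::] Qs = a ++ up :: nseq k dn.
  elim: (last [::] Qs) nQ => [|c w IH] //; case: (posnP (nup w)) => [nw|/IH[a [k ->]] _].
    have -> : w = nseq (size w) dn.
      by elim: w nw {IH} => [|[] w IH] //=; rewrite nup_cons add0n => /IH {1}->.
    by case: c => //=; [exists [::], (size w) | rewrite nup_cons nup_nseq_dn].
  by exists (c :: a), k.
have [c1 e1] := interleave_last l sz Q0.
have [c2 e2] := interleave_last l sz' Q0.
move: ns nt; rewrite e1 e2 ek -!catA /= -!nseqD !nup_cat !nup_cons !nup_nseq_dn => ns nt.
rewrite !catA => d; rewrite -(leq_add2l k); apply: dominated_tail d.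
by rewrite !nup_cat; lia.
Qed.

(** The entries of [s] are raised to those of [t] from left to right: the down
    steps moved across the first factor join the block after it, and
    the rest of [s] remains a chain below the raised entry. *)
Lemma tamari_interleave m n (X : Dy m n) b l s t Qs : all (irr m) Qs ->
  path geq l s -> path geq l t -> all2 leq s t ->
  (X : path_word) = b ++ interleave l s Qs ->
  exists2 Y : Dy m n, tamari X Y & (Y : path_word) = b ++ interleave l t Qs.
Proof.
elim: Qs X b l s t => [|Q Qs IH] X b l [|a s] [|c t] //=;
  try by move=> *; exists X => //; exact: connect0.
case/andP=> iQ iQs /andP[al ps] /andP[cl pt] /andP[ac st] eX.
have e : nseq (l - a) dn = nseq (l - c) dn ++ nseq (c - a) dn.
  by rewrite -nseqD; congr nseq; lia.
have [|Y XY eY] := @tamari_push m n X (b ++ nseq (l - c) dn) (c - a) Q (interleave a s Qs) iQ.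
  by rewrite eX e -!catA.
have ps' : path geq c s by case: s ps {st eX eY} => //= d s /andP[da ->]; rewrite andbT (leq_trans da).
have [|Z YZ eZ] := IH Y (b ++ nseq (l - c) dn ++ Q) c s t iQs ps' pt st.
  by rewrite eY interleave_nseq_cat // -!catA.
by exists Z; [exact: connect_trans YZ | rewrite eZ -!catA].
Qed.

(** * The product and the bounds as interleavings *)

Lemma path_geq_all l s : path geq l s -> all (geq l) s.
Proof. by apply: order_path_min => a b c /= ba ac; exact: leq_trans ba. Qed.

Lemma path_geq_last l s : path geq l s -> all (leq (last l s)) (l :: s).
Proof.
elim: s l => [|t s IH] l /=; first by rewrite leqnn.
by case/andP=> tl /IH /= /andP[lt ->]; rewrite lt (leq_trans lt).
Qed.

Lemma all2_nseq_leq c s : all2 leq (nseq (size s) c) s = all (leq c) s.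
Proof. by elim: s => //= t s ->. Qed.

Lemma all2_leq_nseq l c s : 0 < size s -> path geq l s -> last l s <= c ->
  all2 leq s (rcons (nseq (size s).-1 l) c).
Proof.
case/lastP: s => // s x _ /path_geq_all; rewrite size_rcons succnK last_rcons all_rcons.
by case/andP=> _; elim: s => [|t s IH] /=; rewrite ?andbT // => /andP[-> /IH H] /H.
Qed.

(** What precedes the down steps of last level; it ends with the last up step. *)
Definition stem {m} (P : mdyck m) : path_word := take (size P - L P) P.

Lemma stemE m (P : mdyck m) : (P : path_word) = stem P ++ nseq (L P) dn.
Proof. exact: mdyck_tail. Qed.

Notation words := (map (@mdyck_word _)).

Lemma prime_words m (Q : mdyck m) :
  [/\ all (irr m) (words (prime_factors Q)), flatten (words (prime_factors Q)) = Q
    & 0 < size (words (prime_factors Q))].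
Proof.
have [fl al] := factor_words_flatten (mdyck_dyck Q) (leqnn _).
rewrite map_prime_factors; split=> //; case: factor_words fl => // e.
by have := mdyck_size Q; rewrite -e.
Qed.

Lemma foldl_map {S T R : Type} (f : R -> T -> R) (g : S -> T) z s :
  foldl f z (map g s) = foldl (fun x y => f x (g y)) z s.
Proof. by elim: s z => //=. Qed.

(** Successive concatenations insert each factor into the final run of down steps;
    after the first one, the last [t] of them are again available. *)
Lemma foldl_cat_at m (X : mdyck m) b l (s : seq nat) (Qs : seq (mdyck m)) :
  (X : path_word) = b ++ nseq l dn -> l <= L X -> path geq l s -> size s = size Qs ->
  (foldl (fun Y tQ => cat_at Y tQ.1 tQ.2) X (zip s Qs) : path_word)
    = b ++ interleave l s (words Qs).
Proof.
elim: s Qs X b l => [|t s IH] [|Q Qs] X b l //= eX lX /andP[tl ps] [sz].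
have tX : t <= L X by apply: leq_trans lX.
rewrite (IH Qs _ (b ++ nseq (l - t) dn ++ Q) t) ?L_cat_at ?leq_addl // -!catA //.
rewrite val_cat_at // cat_wordE // [RHS]catA; congr (_ ++ _).
rewrite eX size_cat size_nseq -addnBA // -{2}(subnK tl) nseqD catA.
by rewrite take_size_cat // size_cat size_nseq.
Qed.

Lemma slash_word m (P Q : mdyck m) i :
  (slash_path P i Q : path_word) = stem P ++ interleave (L P)
    (nseq (size (words (prime_factors Q))) (cmin m i P)) (words (prime_factors Q)).
Proof.
have [_ fl sz] := prime_words Q; have [le _] := andP (exact_max_bounds m i P).
rewrite interleave_nseq // fl.
by rewrite (@foldl_cat_at m P _ _ [:: cmin m i P] [:: Q] (stemE P)) //= le.
Qed.

Lemma backslash_word m (P Q : mdyck m) i :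
  (backslash_path P i Q : path_word) = stem P ++ interleave (L P)
    (rcons (nseq (size (words (prime_factors Q))).-1 (L P)) (cmax m i P))
    (words (prime_factors Q)).
Proof.
have [_ le] := andP (exact_max_bounds m i P).
rewrite /backslash_path; case: prime_factors (@prime_factors_neq0 m Q) => // Q1 Qs _.
case/lastP: Qs => [|Qs Qr].
  by rewrite (@foldl_cat_at m P _ _ [:: cmax m i P] [:: Q1] (stemE P)) //= le.
rewrite belast_rcons last_rcons -rcons_cons map_rcons size_rcons succnK interleave_rcons.
rewrite (@foldl_cat_at m P _ _ [:: L P; cmax m i P] [:: concat0 Q1 Qs; Qr] (stemE P)) //=.
  by rewrite subnn val_concat0.
by rewrite leqnn le.
Qed.

(** For the inclusion from left to right, Z begins with [stem P] and erasing the
    down steps of P from the rest leaves Q; the bounds on the last block compare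
    trailing down steps. The converse pushes down steps across the factors. *)
Lemma interval_words m n1 n2 (P : Dy m n1) (Q : Dy m n2) i (Z : Dy m (n1 + n2)) :
  0 < m ->
  tamari (slash P i Q) Z && tamari Z (backslash P i Q) <->
  exists s, [/\ size s = size (prime_factors Q), path geq (L P) s,
    cmin m i P <= last (L P) s <= cmax m i P
    & (Z : path_word) = stem P ++ interleave (L P) s (words (prime_factors Q))].
Proof.
move=> m0; have [irrQ flQ Q0] := prime_words Q.
have [cL CL] := andP (exact_max_bounds m i P).
have := slash_word P Q i; have := backslash_word P Q i.
rewrite -(size_map (@mdyck_word m)).
move: (words _) irrQ flQ Q0 => Qs irrQ flQ Q0.
set lo := nseq (size Qs) _; set hi := rcons _ _ => ehi elo.
have slo : size lo = size Qs by rewrite size_nseq.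
have shi : size hi = size Qs by rewrite size_rcons size_nseq prednK.
have dQs : all (is_mdyck m) Qs by apply: sub_all irrQ => w /irrP[].
have plo : path geq (L P) lo.
  by rewrite /lo; case: (size Qs) => //= k; rewrite cL; elim: k => //= k ->; rewrite leqnn.
have phi : path geq (L P) hi.
  by rewrite /hi; elim: (size Qs).-1 => /= [|k ->]; rewrite ?CL ?leqnn.
have nlast : 0 < nup (last [::] Qs).
  case: (Qs) Q0 irrQ => // q qs _ /allP /(_ _ (mem_last q qs)) /= /irrP[d sz _].
  exact: is_mdyck_nup d sz.
split.
  case/andP=> lZ Zu; have dl := tamari_dominated lZ; have du := tamari_dominated Zu.
  rewrite /= elo in dl; rewrite /= ehi in du.
  have [z ez] := dominated_squeeze dl du.
  have pz : inner_word m 0 z = flatten Qs.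
    apply: dominated_anti.
      by rewrite -(@inner_interleave m (L P) hi Qs) //; exact (tamari_inner Zu ez ehi).
    by rewrite -(@inner_interleave m (L P) lo Qs) //; exact (tamari_inner lZ elo ez).
  have [l [s [sz ps es]]] := inner_interleave_inv m0 irrQ pz.
  (* Both words have the same size, and the factors account for equal parts. *)
  have el : l = L P.
    case: (dl) => + _; rewrite ez es !size_cat !size_interleave // sz slo.
    by move/eqP; rewrite eqn_add2l eqn_add2r => /eqP.
  rewrite {}el in es ps; rewrite {}es in ez; rewrite ez in dl du.
  exists s; split=> //.
  have := dominated_last slo sz Q0 nlast dl.
  have := dominated_last sz shi Q0 nlast du.
  rewrite last_rcons => ->; rewrite andbT /lo.
  by case: (size Qs) Q0 => //= k _; rewrite (last_nth 0) size_nseq -[_ :: _]/(nseq k.+1 _) nth_nseq ltnSn.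
case=> s [sz ps /andP[cs sC] eZ]; have /andP[_ als] := path_geq_last ps.
apply/andP; split.
  have [|Y lY eY] := @tamari_interleave m _ (slash P i Q) _ _ lo s Qs irrQ plo ps _ elo.
    rewrite /lo -sz all2_nseq_leq; apply: sub_all als => t; exact: leq_trans.
  suff -> : Z = Y by [].
  by do 2 apply: val_inj; rewrite /= eZ eY.
have [|Y lY eY] := @tamari_interleave m _ Z _ _ s hi Qs irrQ ps phi _ eZ.
  by rewrite /hi -sz all2_leq_nseq // sz.
suff -> : backslash P i Q = Y by [].
by do 2 apply: val_inj; rewrite /= eY -ehi.
Qed.

(** * Compositions and their tail sums *)

Definition tail_sum {l r} (la : {ffun 'I_r.+1 -> 'I_l.+1}) j := \sum_(k < r.+1 | j <= k) la k.

Definition tails {l r} (la : {ffun 'I_r.+1 -> 'I_l.+1}) : seq nat :=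
  [seq tail_sum la j | j <- iota 1 r].

Lemma tail_sum_rec l r (la : {ffun 'I_r.+1 -> 'I_l.+1}) (j : 'I_r.+1) :
  tail_sum la j = la j + tail_sum la j.+1.
Proof.
rewrite /tail_sum (bigD1 j) //=; congr (_ + _); apply: eq_bigl => k.
by rewrite [RHS]ltn_neqAle andbC eq_sym.
Qed.

Lemma tails_path l r (la : {ffun 'I_r.+1 -> 'I_l.+1}) h : tail_sum la 0 = h ->
  path geq h (tails la).
Proof.
move=> <-.
have H j n : j + n <= r -> path geq (tail_sum la j) [seq tail_sum la j | j <- iota j.+1 n].
  elim: n j => //= n IH j le; rewrite IH ?andbT; last by lia.
  have jr : j < r.+1 by lia.
  by rewrite (tail_sum_rec la (Ordinal jr)) leq_addl.
exact: H.
Qed.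

Lemma tails_last l r (la : {ffun 'I_r.+1 -> 'I_l.+1}) h : tail_sum la 0 = h ->
  last h (tails la) = la ord_max.
Proof.
move=> <-.
have -> : last (tail_sum la 0) (tails la) = tail_sum la r.
  by rewrite /tails last_map (last_nth 0) size_iota -[_ :: _]/(iota 0 r.+1) nth_iota.
rewrite -[tail_sum la r]/(tail_sum la (@ord_max r)) tail_sum_rec.
by rewrite [tail_sum _ _]big1 ?addn0 // => k lt; have := ltn_ord k; rewrite ltnS leqNgt lt.
Qed.

Lemma tails_inj l r (la la' : {ffun 'I_r.+1 -> 'I_l.+1}) :
  tail_sum la 0 = tail_sum la' 0 -> tails la = tails la' -> la = la'.
Proof.
move=> e0 e.
have T j : tail_sum la j = tail_sum la' j.
  case: j => // j; case: (leqP r j) => lt.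
    by rewrite /tail_sum !big1 // => k lk; have := ltn_ord k; lia.
  have := congr1 (fun s => nth 0 s j) e.
  by rewrite !(nth_map 0) ?size_iota // nth_iota.
apply/ffunP => j; apply: val_inj; apply/eqP.
by rewrite -(eqn_add2r (tail_sum la j.+1)) -tail_sum_rec T tail_sum_rec T.
Qed.

(** The composition is made of the consecutive differences of [l :: s], the last
    entry of [s] being compared with the default value 0 of [nth]. *)
Lemma tails_surj l r s : size s = r -> path geq l s ->
  exists2 la : {ffun 'I_r.+1 -> 'I_l.+1}, tail_sum la 0 = l & tails la = s.
Proof.
move=> <- ps; set T := nth 0 (l :: s).
have Tl j : T j <= l.
  rewrite /T; case: j => // j /=; case: (ltnP j (size s)) => lt; last by rewrite nth_default.
  by have /allP := path_geq_all ps; apply; exact: mem_nth.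
have Tdec j : T j.+1 <= T j.
  case: (ltnP j (size s)) => lt; last by rewrite /T /= nth_default.
  by have /(pathP 0) := ps; apply.
pose la := [ffun j : 'I_(size s).+1 => inord (T j - T j.+1) : 'I_l.+1].
have laT j : j <= (size s).+1 -> tail_sum la j = T j.
  have [n] := ubnP ((size s).+1 - j); elim: n j => // n IH j ltn.
  rewrite leq_eqVlt => /orP[/eqP ->|lt].
    rewrite [tail_sum _ _]big1 ?/T /= ?nth_default //.
    by move=> k lk; have := ltn_ord k; lia.
  rewrite (tail_sum_rec la (Ordinal lt)) /= IH //; last by lia.
  rewrite ffunE inordK /=; first by rewrite subnK.
  by rewrite ltnS (leq_trans (leq_subr _ _)).
exists la; first exact: laT.
apply: (@eq_from_nth _ 0); rewrite /tails size_map size_iota // => j lt.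
by rewrite (nth_map 0) ?size_iota // nth_iota // laT //; lia.
Qed.

(** The j-th factor is inserted at the j-th tail sum. *)
Lemma star_lambda_word m (P : mdyck m) (Qs : seq (mdyck m))
    (la : {ffun 'I_(size Qs).+1 -> 'I_(L P).+1}) : la \in Lambda (size Qs) P ->
  (star_lambda P Qs la : path_word) = stem P ++ interleave (L P) (tails la) (words Qs).
Proof.
rewrite inE => /eqP sla.
have e0 : tail_sum la 0 = L P := sla.
rewrite -(@foldl_cat_at m P) ?size_map ?size_iota //; last 2 first.
- exact: stemE.
- exact: tails_path.
congr mdyck_word; rewrite /star_lambda.
have -> : zip (tails la) Qs =
    [seq (tail_sum la (val j).+1, tnth (in_tuple Qs) j) | j <- enum 'I_(size Qs)].
  rewrite -[RHS](zip_map (fun j : 'I_(size Qs) => tail_sum la j.+1)).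
  rewrite (map_tnth_enum (in_tuple Qs)) /tails (iotaDl 1 0) -val_enum_ord -!map_comp.
  by [].
by rewrite foldl_map.
Qed.

Unset Implicit Arguments.
Local Open Scope ring_scope.

Theorem proposition4p4p5 (K : fieldType) (m : nat) (hm : (1 <= m)%N)
    (n1 n2 : nat) (hn1 : (1 <= n1)%N) (hn2 : (1 <= n2)%N)
    (P : Dy m n1) (Q : Dy m n2) (i : nat) (hi : (i <= m)%N) :
  star K i P Q =
    \sum_(Z : Dy m (n1 + n2)
          | tamari (slash P i Q) Z && tamari Z (backslash P i Q))
      << (Z : mdyck m) >>.
Proof.
have [_ flQ _] := prime_words Q.
(* [star_lambda] has the size of Z only on [Lambda], hence a default value. *)
pose g la : Dy m (n1 + n2) := insubd (slash P i Q) (star_lambda P (prime_factors Q) la).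
have inA la : la \in LambdaI m i (size (prime_factors Q)) P ->
    [/\ la \in Lambda (size (prime_factors Q)) P, tail_sum la 0 = L P
      & (cmin m i P <= la ord_max <= cmax m i P)%N].
  rewrite inE => /andP[laL em]; split=> //; first by move: laL; rewrite inE => /eqP.
  by rewrite -exact_maxE // -ltnS ltn_ord.
have gE la : la \in Lambda (size (prime_factors Q)) P ->
    (g la : mdyck m) = star_lambda P (prime_factors Q) la.
  move=> laL; rewrite /g insubdK // unfold_in star_lambda_word //.
  rewrite nup_cat nup_interleave ?flQ; last by rewrite !size_map size_iota.
  rewrite (eqP (valP Q)) eqn_add2r -[X in _ == X](eqP (valP P)).
  by rewrite [X in _ == nup X]stemE nup_cat nup_nseq_dn addn0.
rewrite /star (eq_bigr (fun la => << (g la : mdyck m) >>)); last first.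
  by move=> la /inA[laL _ _]; rewrite gE.
rewrite -(big_imset (fun Z : Dy m (n1 + n2) => << (Z : mdyck m) >>)); last first.
  move=> la la' /inA[laL e _] /inA[laL' e' _] /(congr1 (fun Z : Dy m _ => (Z : path_word))).
  rewrite !gE // !star_lambda_word // => /eqP; rewrite eqseq_cat // eqxx => /eqP H.
  apply: tails_inj; first by rewrite e e'.
  have [irrQ _ _] := prime_words Q.
  apply: interleave_inj irrQ _ _ _ _ H.
  - exact: tails_path.
  - exact: tails_path.
  - by rewrite !size_map size_iota.
  - by rewrite !size_map size_iota.
apply: eq_bigl => Z; apply/imsetP/idP => [[la /inA[laL e le] ->]|].
  apply/interval_words => //; exists (tails la); split.
  - by rewrite size_map size_iota.
  - exact: tails_path.
  - by rewrite tails_last.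
  - by rewrite gE // star_lambda_word.
move=> /interval_words[] // s [sz ps le eZ].
have [la e els] := tails_surj sz ps.
have laL : la \in Lambda (size (prime_factors Q)) P by rewrite inE; apply/eqP.
exists la; last by do 2 apply: val_inj; rewrite /= gE // star_lambda_word // els eZ.
rewrite inE laL exact_maxE //; last by rewrite -ltnS ltn_ord.
by rewrite -(tails_last e) els.
Qed.
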